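(* Let $I$ be a non-empty subset of $\mathbb{N}$, let $S\subseteq \mathbb{N}^{(I)}$ be a gap absorbing monoid and let $\mathbf{s}\in S$. If $\mathbf{s}$ is a Betti element of $S$, then $\mathbf{s}\in 2\mathcal{A}(S)\cup 3\mathcal{A}(S)$.
   Context: $\mathbb{N}$ is the set of non-negative integers. For a non-empty set $I\subseteq\mathbb{N}$, $\mathbb{N}^{(I)}$ is the additive monoid (componentwise addition) of all sequences $(n_i)_{i\in I}$ of non-negative integers with $n_i=0$ for all but finitely many $i$; $\mathbf{0}$ is the zero sequence. For $X,Y\subseteq\mathbb{N}^{(I)}$, $X+Y=\{x+y: x\in X,\ y\in Y\}$, $0X=\{\mathbf{0}\}$ and $nX=(n-1)X+X$ for $n>0$. For a submonoid $S$ of $\mathbb{N}^{(I)}$: $S^*=S\setminus\{\mathbf{0}\}$; $\mathcal{H}(S)=\mathbb{N}^{(I)}\setminus S$ is the set of gaps; $\mathcal{A}(S)=S^*\setminus(S^*+S^* )$ is the set of atoms. A submonoid $S$ of $\mathbb{N}^{(I)}$ is gap absorbing if $2\mathcal{H}(S)\subseteq\mathcal{H}(S)\cup\mathcal{A}(S)\cup 2\mathcal{A}(S)$ and $\mathcal{H}(S)+\mathcal{A}(S)\subseteq\mathcal{A}(S)\cup 2\mathcal{A}(S)$. Write $\mathbf{a}\le_S\mathbf{b}$ if $\mathbf{b}-\mathbf{a}\in S$. For $\mathbf{s}\in S$, $\mathbf{G}_{\mathbf{s}}$ is the graph whose vertices are the atoms $\mathbf{a}$ of $S$ with $\mathbf{a}\le_S\mathbf{s}$,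 two distinct vertices $\mathbf{a},\mathbf{b}$ being joined by an edge if $\mathbf{a}+\mathbf{b}\le_S\mathbf{s}$. The element $\mathbf{s}$ is a Betti element of $S$ if $\mathbf{G}_{\mathbf{s}}$ is not connected, i.e. it has at least two connected components (the empty graph $\mathbf{G}_{\mathbf{0}}$ is not counted as disconnected). *)

(* Defs.v *)
From HB Require Import structures.
From mathcomp Require Import all_boot all_algebra.
From mathcomp Require Import finmap multiset.
From mathcomp Require Import boolp classical_sets.
From Stdlib Require Import Relation_Operators.

Set Implicit Arguments.
Unset Strict Implicit.
Unset Printing Implicit Defensive.

Import GRing.Theory.

Local Open Scope mset_scope.
Local Open Scope classical_set_scope.
Local Open Scope ring_scope.

(* Finite multisets on K are the finitely supported functions K -> nat, so
   {mset I}, for I : set nat seen as a type, is the monoid N^(I). *)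
Section MsetNmodule.
Variable K : choiceType.

Let msetDA_assoc : associative (@msetD K).
Proof. exact: msetDA. Qed.

Let msetDC_comm : commutative (@msetD K).
Proof. exact: msetDC. Qed.

Let mset0D_id : left_id mset0 (@msetD K).
Proof. exact: mset0D. Qed.

HB.instance Definition _ := Choice.copy {mset K} {fsfun K -> nat with 0%N}.
HB.instance Definition _ :=
  GRing.isNmodule.Build {mset K} msetDA_assoc msetDC_comm mset0D_id.

End MsetNmodule.

Section GapAbsorbing.
Variable V : nmodType.
Implicit Types (S X Y : set V) (s a b : V).

Definition sumset X Y : set V := [set x + y | x in X & y in Y].

Fixpoint nfold (n : nat) X : set V :=
  if n is m.+1 then sumset (nfold m X) X else [set 0].

Definition submonoid S : Prop := S 0 /\ sumset S S `<=` S.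

Definition star S : set V := S `\ 0.

Definition gaps S : set V := ~` S.

Definition atoms S : set V := star S `\` sumset (star S) (star S).

Definition gap_absorbing S : Prop :=
  [/\ submonoid S,
      nfold 2 (gaps S) `<=` gaps S `|` atoms S `|` nfold 2 (atoms S) &
      sumset (gaps S) (atoms S) `<=` atoms S `|` nfold 2 (atoms S)].

(* a <=_S b, i.e. b - a exists in V and lies in S; in a cancellative V such as
   N^(I) the witness c is unique. *)
Definition leS S a b : Prop := exists2 c, S c & b = a + c.

Definition vertices S s : set V := [set a | atoms S a /\ leS S a s].

Definition edge S s a b : Prop :=
  [/\ vertices S s a, vertices S s b, a <> b & leS S (a + b) s].

(* A graph without vertices counts as connected. *)
Definition graph_connected S s : Prop :=
  forall a b, vertices S s a -> vertices S s b ->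
    clos_refl_trans V (edge S s) a b.

Definition betti S s : Prop := S s /\ ~ graph_connected S s.

End GapAbsorbing.

(* Main.v *)
(* Let s in S be neither an atom nor in 2A(S) u 3A(S).  Since gaps plus atoms
   are sums of at most two atoms, s is not a gap plus at most two atoms, so two
   atoms a, b with a + b <= s componentwise are adjacent in G_s.  Given vertices
   a and b of G_s, refine s = a + (s - a) = b + (s - b) into s = y + x + x' + z
   with a = y + x and b = y + x'.  If x or x' is a gap, then z is a nonzero
   element of S and any atom below z is adjacent to both a and b.  Otherwise
   atoms p below x and p' below x' give a path a - p' - p - b. *)

Require Import Defs.
From mathcomp Require Import all_boot all_algebra.
From mathcomp Require Import finmap multiset.
From mathcomp Require Import boolp classical_sets.
From mathcomp Require Import zify.
From Stdlib Require Import Relation_Operators.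

Set Implicit Arguments.
Unset Strict Implicit.

Import GRing.Theory.

Local Open Scope mset_scope.
Local Open Scope classical_set_scope.

Section Multisets.
Variable K : choiceType.
Implicit Types x y a b c d : {mset K}.
Local Open Scope ring_scope.

Lemma mset_addE x y i : (x + y) i = (x i + y i)%N.
Proof. exact: (msetE2 x y i).1.1.1. Qed.

Lemma size_mset_add x y : size (x + y : {mset K}) = (size x + size y)%N.
Proof.
rewrite -size_cat; apply/perm_size/allP => i _ /=.
by rewrite count_cat !count_mem_mset mset_addE.
Qed.

Lemma mset_size_eq0 x : size x = 0%N -> x = 0.
Proof.
move=> /size0nil x0; apply/msetP => i.
by rewrite -count_mem_mset x0 [RHS]mset0E.
Qed.

(** Take [y] to be the componentwise minimum of [a] and [b]. In each coordinate [x] or [x'] then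
    vanishes, and the excess [x'] of [b] over [a] is at most [c], so the truncated differences are
    exact. *)
Lemma mset_refinement a b c d : a + c = b + d ->
  exists y x x' z, [/\ a = y + x, b = y + x', c = x' + z & d = x + z].
Proof.
move=> E.
have {}E i : (a i + c i = b i + d i)%N by rewrite -!mset_addE E.
exists (msetI a b), (msetB a (msetI a b)), (msetB b (msetI a b)),
  (msetB c (msetB b (msetI a b))).
by split; apply/msetP => i; rewrite mset_addE !msetE2; have := E i; lia.
Qed.

End Multisets.

Ltac mset_addAC := apply/msetP => ?; rewrite !mset_addE; lia.

Section GapAbsorbing.
Variables (V : nmodType) (S : set V).
Local Open Scope ring_scope.

Lemma atomsS a : atoms S a -> S a.
Proof. by case=> -[]. Qed.

Lemma atoms_neq0 a : atoms S a -> a <> 0.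
Proof. by case=> -[]. Qed.

Lemma atoms_add a x y : atoms S a -> S x -> S y -> a = x + y -> x = 0 \/ y = 0.
Proof.
move=> [_ aN] Sx Sy aE; have [|x0] := pselect (x = 0); first by left.
have [|y0] := pselect (y = 0); first by right.
by case: aN; exists x => //; exists y.
Qed.

Lemma nfold2P (X : set V) s :
  nfold 2 X s <-> exists a b, [/\ X a, X b & s = a + b].
Proof.
split=> [[_ [_ /= -> [a Xa <-]] [b Xb <-]]|[a [b [Xa Xb ->]]]].
  by exists a, b; rewrite add0r.
exists a; last by exists b.
by exists 0 => //; exists a => //; rewrite add0r.
Qed.

Hypothesis gapS : gap_absorbing S.

Lemma gap_add_atom h a : ~ S h -> atoms S a ->
  (atoms S `|` nfold 2 (atoms S)) (h + a).
Proof. by case: gapS => _ _ + hN Aa; apply; exists h => //; exists a. Qed.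

Lemma gap_add_atom2 h a b : ~ S h -> atoms S a -> atoms S b ->
  (nfold 2 (atoms S) `|` nfold 3 (atoms S)) (h + a + b).
Proof.
move=> hN Aa Ab; case: (gap_add_atom hN Aa) => [Aha|A2ha].
  by left; apply/nfold2P; exists (h + a), b.
by right; exists (h + a) => //; exists b.
Qed.

End GapAbsorbing.

Section Betti.
Variables (K : choiceType) (S : set {mset K}).
Hypothesis gapS : gap_absorbing S.
Local Open Scope ring_scope.

Lemma gap_absorbing0 : S 0.
Proof. by case: gapS => -[]. Qed.

Lemma gap_absorbingD x y : S x -> S y -> S (x + y).
Proof.
by case: gapS => -[_ SD] _ _ Sx Sy; apply: SD; exists x => //; exists y.
Qed.

(** Descent on the size: a nonzero non-atom of [S] splits into two nonzero elements of [S], and the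
    summand [u] is strictly smaller. *)
Lemma atom_below x : S x -> x <> 0 -> exists2 p, atoms S p & leS S p x.
Proof.
elim: {x}(size x) {-2}x (leqnn (size x)) => [|n IH] x xn Sx x0.
  by case: x0; apply: mset_size_eq0; lia.
have [Ax|NAx] := pselect (atoms S x).
  by exists x => //; exists 0; [exact: gap_absorbing0 | rewrite addr0].
have [u [Su u0] [v [Sv v0] uvx]] : sumset (star S) (star S) x.
  by apply: contrapT => xN; apply: NAx.
have v_gt0 : size (v : {mset K}) <> 0%N by move/mset_size_eq0.
have un : (size (u : {mset K}) <= n)%N by move: xn; rewrite -uvx size_mset_add; lia.
have [p Ap [w Sw uE]] := IH u un Su u0.
by exists p => //; exists (w + v); [exact: gap_absorbingD | rewrite -uvx uE addrA].
Qed.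

Variable s : {mset K}.
Hypotheses (sNA : ~ atoms S s)
  (sN23 : ~ (nfold 2 (atoms S) `|` nfold 3 (atoms S)) s).

Lemma not_gap_add_atom h a : atoms S a -> s = h + a -> S h.
Proof.
move=> Aa sE; apply: contrapT => hN.
by case: (gap_add_atom gapS hN Aa); rewrite -sE // => s2; case: sN23; left.
Qed.

Lemma not_gap_add_atom2 h a b : atoms S a -> atoms S b -> s = h + a + b -> S h.
Proof.
move=> Aa Ab sE; apply: contrapT => hN.
by apply: sN23; rewrite sE; exact: gap_add_atom2.
Qed.

Lemma atoms_connected a b h : atoms S a -> atoms S b -> s = h + a + b ->
  clos_refl_trans _ (edge S s) a b.
Proof.
move=> Aa Ab sE; have Sh := not_gap_add_atom2 Aa Ab sE.
(* Equal atoms get the empty path, so paths can later be concatenated without checking that their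
   atoms differ. *)
have [<-|ab] := pselect (a = b); first exact: rt_refl.
have [Sa Sb] := (atomsS Aa, atomsS Ab).
apply: rt_step; split=> //.
- by split=> //; exists (h + b); [exact: gap_absorbingD | rewrite sE; mset_addAC].
- by split=> //; exists (h + a); [exact: gap_absorbingD | rewrite sE addrC].
- by exists h => //; rewrite sE; mset_addAC.
Qed.

(** If [z] were a gap, [z + a] would be a sum of one or two atoms, and [s] would be the gap [x] plus
    these atoms. If [z] were zero, [s] would be [x + a]. Both are excluded. *)
Lemma gap_rest x a z : ~ S x -> atoms S a -> s = x + (a + z) -> S z /\ z <> 0.
Proof.
move=> xN Aa sE; split=> [|z0]; last first.
  by apply/xN/(not_gap_add_atom Aa); rewrite sE z0 addr0.
apply: contrapT => zN; apply: xN.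
have [Aza|/nfold2P[d [d' [Ad Ad' zaE]]]] := gap_add_atom gapS zN Aa.
  by apply: (not_gap_add_atom Aza); rewrite sE [z + a]addrC.
by apply: (not_gap_add_atom2 Ad Ad'); rewrite sE [a + z]addrC zaE addrA.
Qed.

Lemma vertices_connected a b y x x' z : atoms S a -> atoms S b ->
  a = y + x -> b = y + x' -> s = y + x + x' + z ->
  clos_refl_trans _ (edge S s) a b.
Proof.
move=> Aa Ab aE bE sE.
(* Since [s = a + x' + z = b + x + z], an atom below [z] can be added to [a] or to [b] without
   leaving [s]. *)
have via_z : S z /\ z <> 0 -> clos_refl_trans _ (edge S s) a b.
  move=> [Sz z0]; have [p Ap [w Sw zE]] := atom_below Sz z0.
  apply: (@rt_trans _ _ _ p).
    by apply: (@atoms_connected _ _ (x' + w)) => //; rewrite sE aE zE; mset_addAC.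
  by apply: (@atoms_connected _ _ (x + w)) => //; rewrite sE bE zE; mset_addAC.
have [Sx|xN] := pselect (S x); last first.
  by apply/via_z/(gap_rest xN Ab); rewrite sE bE; mset_addAC.
have [Sx'|x'N] := pselect (S x'); last first.
  by apply/via_z/(gap_rest x'N Aa); rewrite sE aE; mset_addAC.
(* No atom lies below zero, so vanishing [x] or [x'] is treated apart: one of [a], [b] is then the
   other plus an element of [S], and two atoms so related coincide. *)
have [x0|x0] := pselect (x = 0).
  have ya : y = a by rewrite aE x0 addr0.
  have bax' : b = a + x' by rewrite -ya.
  have [a0|x'0] := atoms_add Ab (atomsS Aa) Sx' bax'.
    by case: (atoms_neq0 Aa).
  by rewrite bax' x'0 addr0; exact: rt_refl.
have [x'0|x'0] := pselect (x' = 0).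
  have yb : y = b by rewrite bE x'0 addr0.
  have abx : a = b + x by rewrite -yb.
  by have [/(atoms_neq0 Ab)|/x0] := atoms_add Aa (atomsS Ab) Sx abx.
have [p Ap [w _ xE]] := atom_below Sx x0.
have [p' Ap' [w' _ x'E]] := atom_below Sx' x'0.
(* The path crosses over: [p'] lies in the part of [s] outside [a], and [p] in the part outside
   [b]. *)
apply: (@rt_trans _ _ _ p').
  by apply: (@atoms_connected _ _ (w' + z)) => //; rewrite sE aE x'E; mset_addAC.
apply: (@rt_trans _ _ _ p).
  by apply: (@atoms_connected _ _ (y + w + w' + z)) => //;
    rewrite sE xE x'E; mset_addAC.
by apply: (@atoms_connected _ _ (w + z)) => //; rewrite sE bE xE; mset_addAC.
Qed.

End Betti.

(** An atom has no vertex but itself, so a Betti element is never an atom. *)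
Lemma atom_graph_connected (V : nmodType) (S : set V) (s : V) :
  atoms S s -> graph_connected S s.
Proof.
move=> As; have vE a : vertices S s a -> a = s.
  move=> [Aa [c Sc sE]].
  have [/(atoms_neq0 Aa) //|c0] := atoms_add As (atomsS Aa) Sc sE.
  by rewrite sE c0 addr0.
by move=> a b /vE -> /vE ->; exact: rt_refl.
Qed.

Unset Implicit Arguments.

Theorem theorem3p8 (I : set nat) (I_neq0 : I !=set0) (S : set {mset I})
    (gapS : gap_absorbing S) (s : {mset I}) (Ss : S s) (bettis : betti S s) :
  (nfold 2 (atoms S) `|` nfold 3 (atoms S)) s.
Proof.
apply: contrapT => sN23; case: bettis => _; apply.
have [/atom_graph_connected//|sNA] := pselect (atoms S s).
move=> a b [Aa [c _ sac]] [Ab [d _ sbd]].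
have [|y [x [x' [z [aE bE cE _]]]]] := @mset_refinement _ a b c d.
  by rewrite -sac.
apply: (vertices_connected gapS sNA sN23 Aa Ab aE bE).
by rewrite sac aE cE addrA.
Qed.
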